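(* For $r=5$, there is exactly one (up to isomorphism) irreducible connected $5$-uniform hypergraph $H$ with $\rho(H)\le 4!\sqrt[5]{2+\sqrt5}$, namely the five edge-star $S_5^{(5)}$. For $r\ge 6$, every $r$-uniform hypergraph $H$ with $\rho(H)\le (r-1)!\sqrt[r]{2+\sqrt5}$ is reducible.
   Context: An $r$-uniform hypergraph $H$ is a pair $(V,E)$ with $V$ a finite vertex set and $E\subset\binom{V}{r}$. The degree of a vertex is the number of edges containing it; a leaf vertex is a vertex of degree $1$. The spectral radius of an $r$-uniform hypergraph on $n$ vertices is $$\rho(H)=r!\max_{x\in\mathbb{R}^n_{\ge 0},\,x\ne 0}\frac{\sum_{\{i_1,\dots,i_r\}\in E(H)}x_{i_1}\cdots x_{i_r}}{\sum_{i=1}^n x_i^r}.$$ A hypergraph is connected if any two vertices are joined by a path. An $r$-uniform hypergraph $H$ is extended from an $(r-1)$-uniform hypergraph $H'$ if it is obtained by adding one new vertex to each edge of $H'$ (a different new vertex for each edge). $H$ is irreducible if it is not extended from any $(r-1)$-uniform hypergraph (equivalently, $H$ contains an edge all of whose vertices have degree greater than $1$), and reducible otherwise (equivalently, every edge of $H$ contains a leaf vertex). The five edge-star $S_5^{(5)}$ is the $5$-uniform hypergraph with six edges $F_0=\{v_1,\dots,v_5\}$ and $F_1,\dots,F_5$, where $F_i\cap F_0=\{v_i\}$ for $1\le i\le 5$ and $F_i\cap F_j=\emptyset$ for $1\le i<j\le 5$, and whose vertex set is the union of these edges. *)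

(* Defs.v *)
From HB Require Import structures.
From mathcomp Require Import all_boot all_order all_algebra.
From mathcomp Require Import boolp classical_sets reals exp.

Set Implicit Arguments.
Unset Strict Implicit.
Unset Printing Implicit Defensive.

Import Order.TTheory GRing.Theory Num.Theory.

Record hypergraph (r : nat) := Hypergraph {
  vertices :> finType;
  edges : {set {set vertices}};
  edges_uniform : forall e, e \in edges -> #|e| = r
}.

Definition isomorphic r s (H : hypergraph r) (K : hypergraph s) : Prop :=
  exists2 f : H -> K, bijective f & edges K = [set f @: e | e : {set H} in edges H].

Definition adjacent r (H : hypergraph r) : rel H :=
  fun u v => [exists e in edges H, (u \in e) && (v \in e)].

Definition hconnected r (H : hypergraph r) : Prop :=
  forall u v : H, connect (@adjacent r H) u v.

Section Extension.
Variables (r : nat) (H : hypergraph r).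

(* [inr e] is the vertex added to the edge [e]. *)
Definition ext_vertices : finType := (H + {e : {set H} | e \in edges H})%type.

Definition ext_edges : {set {set ext_vertices}} :=
  [set (inr e : ext_vertices) |: [set (inl v : ext_vertices) | v in val e]
  | e : {e : {set H} | e \in edges H}].

Lemma ext_edges_uniform e : e \in ext_edges -> #|e| = r.+1.
Proof.
case/imsetP=> d _ ->; rewrite cardsU1 card_imset; last by move=> u v [].
rewrite (edges_uniform (valP d)); case: imsetP => [[]|] //.
Qed.

Definition extension : hypergraph r.+1 := Hypergraph ext_edges_uniform.
End Extension.

(* The hypergraph [H'] is simple, so two edges of [H] never arise from the same
   edge of [H']: when two edges of [H] share [r - 1] vertices, a leaf in every
   edge need not suffice for [H] to be an extension. *)
Definition reducible r (H : hypergraph r) : Prop :=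
  exists H' : hypergraph r.-1, isomorphic H (extension H').

Definition irreducible r (H : hypergraph r) : Prop := ~ reducible H.

(* The maximum in the definition is attained, by homogeneity of the quotient
   and compactness, so it is the supremum; on the empty vertex set the value is
   [sup set0 = 0]. *)
Definition spectral_radius (R : realType) r (H : hypergraph r) : R :=
  ((r`!)%:R * sup [set q : R | exists x : H -> R,
      [/\ (forall v, 0 <= x v), (exists v, x v != 0) &
          q = (\sum_(e in edges H) \prod_(v in e) x v)
              / (\sum_(v : H) x v ^+ r)]]%classic)%R.

Section EdgeStar.

(* The vertex [(i, ord0)] is the common vertex of the [i]-th outer edge and of
   the central edge. *)
Definition star_vertices : finType := ('I_5 * 'I_5)%type.

Definition star_center : {set star_vertices} :=
  [set ((i, ord0) : star_vertices) | i : 'I_5].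

Definition star_outer (i : 'I_5) : {set star_vertices} :=
  [set ((i, j) : star_vertices) | j : 'I_5].

Definition star_edges : {set {set star_vertices}} :=
  star_center |: [set star_outer i | i : 'I_5].

Lemma star_edges_uniform e : e \in star_edges -> #|e| = 5.
Proof.
case/setU1P=> [->|/imsetP[i _ ->]]; rewrite card_imset ?card_ord //.
  by move=> i j [].
by move=> j k [].
Qed.

Definition five_edge_star : hypergraph 5 := Hypergraph star_edges_uniform.
End EdgeStar.

(* Main.v *)
Require Import Defs.
From HB Require Import structures.
From mathcomp Require Import all_boot all_order all_algebra.
From mathcomp Require Import boolp classical_sets reals exp.
From mathcomp Require Import finset ring lra.

Set Implicit Arguments.
Unset Strict Implicit.
Unset Printing Implicit Defensive.

Import Order.TTheory GRing.Theory Num.Theory.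
Local Open Scope ring_scope.

(** Write [c] for [2 + sqrt 5].  Spectral radii are compared with
    [(r-1)! c^(1/r)] by polynomial certificates, never by computing a maximum.

    From below: put weights [w e >= 0] on the edges and let [q v] be the total
    weight of the edges at [v].  The test vector [x v = (q v)^(1/r)] shows that
    the spectral radius exceeds the threshold as soon as
    [c * w e ^ r <= \prod_(v in e) q v] for every edge, strictly for one
    ([spectral_radius_gt]).  Extra incidences only increase [q], so a
    certificate found on a tree survives in every hypergraph into which that
    tree is folded, and the overlaps of the edges need few cases.

    From above: split each vertex between its edges with shares [B v e] of sum
    at most [1]; if [c * \prod_(v in e) B v e >= 1] for every edge, AM-GM bounds
    the spectral radius by the threshold ([spectral_radius_le]).

    A hypergraph below the threshold has no two edges sharing [r - 1] vertices,
    since [2^(r-1) > c].  Therefore it is an extension as soon as every edge has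
    a leaf ([leaves_reducible]), and an irreducible one has a core: an edge [e0]
    each of whose vertices lies on another edge.  Weigh [e0] by [c - 1] and
    every other edge by the number of its vertices in [e0].  The other edges
    then satisfy their inequality, and [e0] satisfies its own because
    [(c - 1)^r < c^(r-1)] when [r >= 6].  This excludes cores for [r >= 6].

    For [r = 5] the last inequality is reversed, and the star itself lies below
    the threshold by [c^4 <= (c - 1)^5].  The fan weights still exclude a
    vertex of the core where the other edges count for [2] or more, so
    each vertex of [e0] lies on exactly one other edge and that edge meets [e0]
    only there.  If a further edge [G] met such an edge [F] away from [e0], the
    path [e0], [F], [G] together with the remaining edges at [e0] would exceed
    the threshold ([spectral_radius_tail]); this is the tightest estimate,
    [s (1 + s)^3 < (2 + s)^3] with [s = sqrt 5], that is [75.78 < 76.01].  So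
    the edges at [e0] are pairwise disjoint and touch nothing else, and by
    connectedness [H] is the five edge-star ([core_star]). *)

(** * Certificates for the spectral radius *)

Lemma rootK (R : realType) r (a : R) :
  (0 < r)%N -> 0 <= a -> (a `^ r%:R^-1) ^+ r = a.
Proof.
move=> r0 a0; rewrite -powR_mulrn ?powR_ge0 // -powRrM mulVf ?powRr1 //.
by rewrite pnatr_eq0 -lt0n.
Qed.

Lemma ler_of_exp (R : realType) r (a b : R) :
  (0 < r)%N -> 0 <= a -> 0 <= b -> a ^+ r <= b ^+ r -> a <= b.
Proof. by move=> r0 a0 b0; rewrite ler_pXn2r // nnegrE. Qed.

(** AM-GM applied to the numbers [B v e * x v ^ r] for [v] in [e] bounds each
    edge product; the shares of a vertex sum to at most [1], so summing over the
    edges spends every [x v ^ r] at most once. *)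
Lemma labelling_edge_sum_le (R : realType) r (H : hypergraph r)
    (B : H -> {set H} -> R) (c : R) (x : H -> R) :
    (0 < r)%N -> 0 <= c ->
    (forall e v, 0 <= B v e) ->
    (forall v, \sum_(e in edges H | v \in e) B v e <= 1) ->
    (forall e, e \in edges H -> 1 <= c * \prod_(v in e) B v e) ->
    (forall v, 0 <= x v) ->
  \sum_(e in edges H) \prod_(v in e) x v
    <= c `^ r%:R^-1 / r%:R * \sum_(v : H) x v ^+ r.
Proof.
move=> r0 c0 B0 B1 Bc x0.
have edge_le e : e \in edges H -> \prod_(v in e) x v
    <= c `^ r%:R^-1 / r%:R * \sum_(v in e) B v e * x v ^+ r.
  move=> eH; have S0 : 0 <= \sum_(v in e) B v e * x v ^+ r.
    by apply: sumr_ge0 => v _; rewrite mulr_ge0 ?exprn_ge0.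
  (* Both sides are raised to the power [r] to get rid of the root of [c]. *)
  apply: (@ler_of_exp _ r) => //; first exact: prodr_ge0.
    by rewrite mulr_ge0 // divr_ge0 ?powR_ge0 ?ler0n.
  have AGM := (@leif_AGM R H e (fun v => B v e * x v ^+ r) _).1.
  rewrite -mulrA exprMn rootK // [_^-1 * _]mulrC.
  rewrite (edges_uniform eH) in AGM.
  apply: le_trans (ler_wpM2l c0 (AGM _)); last first.
    by move=> v _; rewrite mulr_ge0 ?exprn_ge0.
  rewrite big_split /= mulrA -prodrXl.
  by rewrite ler_peMl ?Bc // prodr_ge0 // => v _; rewrite exprn_ge0.
apply: le_trans (ler_sum _ edge_le) _.
rewrite -mulr_sumr ler_wpM2l ?divr_ge0 ?powR_ge0 ?ler0n //.
rewrite (exchange_big_dep predT) //=; apply: ler_sum => v _.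
rewrite -mulr_suml ler_piMl ?exprn_ge0 //; exact: B1.
Qed.

Lemma sum_pow_gt0 (R : realType) (T : finType) r (x : T -> R) :
  (forall v, 0 <= x v) -> (exists v, x v != 0) -> 0 < \sum_v x v ^+ r.
Proof.
move=> x0 [v xv]; rewrite (bigD1 v) //= ltr_pwDl //.
  by rewrite exprn_gt0 // lt_neqAle eq_sym xv x0.
by apply: sumr_ge0 => u _; rewrite exprn_ge0.
Qed.

Lemma spectral_radius_le (R : realType) r (H : hypergraph r)
    (B : H -> {set H} -> R) (c : R) :
    (0 < r)%N -> 0 <= c ->
    (forall e v, 0 <= B v e) ->
    (forall v, \sum_(e in edges H | v \in e) B v e <= 1) ->
    (forall e, e \in edges H -> 1 <= c * \prod_(v in e) B v e) ->
  spectral_radius R H <= (r.-1)`!%:R * c `^ r%:R^-1.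
Proof.
case: r H B => // r H B _ c0 B0 B1 Bc; rewrite /spectral_radius /= factS natrM.
rewrite -mulrA mulrCA ler_wpM2l ?ler0n //.
rewrite mulrC -ler_pdivlMr ?ltr0n //; set E := (X in sup X).
have [E0|/set0P E0] := eqVneq E (classical_sets.set0).
  by rewrite E0 sup0 divr_ge0 ?powR_ge0 ?ler0n.
apply: ge_sup => // _ [x [x0 xn0 ->]].
rewrite ler_pdivrMr ?sum_pow_gt0 //.
exact: (labelling_edge_sum_le _ c0 B0 B1 Bc).
Qed.

(** Sharing every vertex equally between all edges is a labelling that exists on
    every hypergraph, so the supremum defining the spectral radius is never the
    default value of an unbounded set. *)
Lemma rayleigh_has_ubound (R : realType) r (H : hypergraph r) : (0 < r)%N ->
  has_ubound [set q : R | exists x : H -> R,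
      [/\ (forall v, 0 <= x v), (exists v, x v != 0) &
          q = (\sum_(e in edges H) \prod_(v in e) x v)
              / (\sum_(v : H) x v ^+ r)]]%classic.
Proof.
move=> r0; set N : R := (#|edges H|.+1)%:R.
have N0 : 0 < N by rewrite ltr0n.
exists ((N ^+ r) `^ r%:R^-1 / r%:R) => _ [x [x0 xn0 ->]].
rewrite ler_pdivrMr ?sum_pow_gt0 //.
apply: (@labelling_edge_sum_le R r H (fun _ _ => N^-1)) => //.
- by rewrite exprn_ge0 // ltW.
- by move=> _ _; rewrite invr_ge0 ltW.
- move=> v; apply: (@le_trans _ _ (\sum_(e in edges H) N^-1)).
    rewrite big_mkcondr; apply: ler_sum => e _.
    by case: ifP => // _; rewrite invr_ge0 ltW.
  by rewrite sumr_const -mulr_natl ler_pdivrMr // mul1r ler_nat.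
- move=> e eH; rewrite prodr_const (edges_uniform eH) exprVn divff //.
  by rewrite expf_neq0 // gt_eqF.
Qed.

Definition wdeg (R : realType) r (H : hypergraph r) (w : {set H} -> R) (v : H) :=
  \sum_(e in edges H | v \in e) w e.

(** With [x v = (wdeg w v)^(1/r)] the denominator of the quotient is
    [\sum_v wdeg w v = r * \sum_e w e], each edge being counted once per vertex,
    and the hypothesis says that the edge product at [e] is at least
    [c^(1/r) * w e].  At a maximiser of the quotient the [r]-th powers have
    this form up to scaling, with [w e] the edge products, so nothing is lost. *)
Lemma spectral_radius_gt (R : realType) r (H : hypergraph r)
    (w : {set H} -> R) (c : R) (e0 : {set H}) :
    (0 < r)%N -> 0 < c -> (forall e, 0 <= w e) ->
    (forall e, e \in edges H -> c * w e ^+ r <= \prod_(v in e) wdeg w v) ->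
    e0 \in edges H -> c * w e0 ^+ r < \prod_(v in e0) wdeg w v ->
  (r.-1)`!%:R * c `^ r%:R^-1 < spectral_radius R H.
Proof.
case: r H w e0 => // r H w e0 _ c0 w0 wc e0H wc0.
have q0 v : 0 <= wdeg w v by apply: sumr_ge0.
rewrite /spectral_radius factS natrM -mulrA mulrCA ltr_pM2l ?ltr0n ?fact_gt0 //.
pose x v := wdeg w v `^ r.+1%:R^-1.
have x0 v : 0 <= x v by exact: powR_ge0.
have xr v : x v ^+ r.+1 = wdeg w v by rewrite rootK.
have P0 (e : {set H}) : 0 <= \prod_(v in e) x v by exact: prodr_ge0.
have PE (e : {set H}) : (\prod_(v in e) x v) ^+ r.+1 = \prod_(v in e) wdeg w v.
  by rewrite -prodrXl; apply: eq_bigr.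
have cw e : (c `^ r.+1%:R^-1 * w e) ^+ r.+1 = c * w e ^+ r.+1.
  by rewrite exprMn rootK // ltW.
have cw0 e : 0 <= c `^ r.+1%:R^-1 * w e by rewrite mulr_ge0 ?powR_ge0.
have Sx : \sum_v x v ^+ r.+1 = r.+1%:R * \sum_(e in edges H) w e.
  under eq_bigr do rewrite xr /wdeg.
  rewrite (exchange_big_dep (fun e => e \in edges H)) /=; last by move=> ? ? _ /andP[].
  rewrite mulr_sumr; apply: eq_bigr => e eH.
  under eq_bigl do rewrite eH.
  by rewrite sumr_const (edges_uniform eH) mulr_natl.
have xn0 : exists v, x v != 0.
  apply: contrapT => xz; have {}xz v : x v = 0.
    by apply/eqP; apply: contrapT => /negP xv; apply: xz; exists v.
  have : \prod_(v in e0) wdeg w v = 0.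
    have /card_gt0P[v ve0] : (0 < #|e0|)%N by rewrite (edges_uniform e0H).
    by rewrite (bigD1 v) //= -xr xz exprS !mul0r.
  by move=> z; move: wc0; rewrite z ltNge mulr_ge0 ?exprn_ge0 // ltW.
have Sx0 := sum_pow_gt0 r.+1 x0 xn0.
have lt_sum : c `^ r.+1%:R^-1 * \sum_(e in edges H) w e
    < \sum_(e in edges H) \prod_(v in e) x v.
  rewrite mulr_sumr (bigD1 e0) //= [ltRHS](bigD1 e0) //=.
  apply: ltr_leD; first by rewrite -(@ltr_pXn2r _ r.+1) ?nnegrE // cw PE.
  apply: ler_sum => e /andP[eH _].
  by apply: (@ler_of_exp _ r.+1) => //; rewrite cw PE wc.
rewrite mulrC -ltr_pdivrMr ?ltr0n //.
apply: lt_le_trans (ub_le_sup (@rayleigh_has_ubound R r.+1 H isT) _).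
  2: by exists x; split.
by rewrite ltr_pdivlMr // Sx mulrA mulfVK ?pnatr_eq0.
Qed.

(** * Lower bounds on weighted degrees and products *)

Section WeightedDegree.
Variables (R : realType) (r : nat) (H : hypergraph r) (w : {set H} -> R).
Hypothesis w_ge0 : forall e, 0 <= w e.
Implicit Types (e f : {set H}) (v : H).

Lemma wdeg_ge0 v : 0 <= wdeg w v. Proof. exact: sumr_ge0. Qed.

Lemma wdeg_ge e v : e \in edges H -> v \in e -> w e <= wdeg w v.
Proof.
by move=> eH ve; rewrite /wdeg (bigD1 e) ?eH //= lerDl sumr_ge0.
Qed.

Lemma wdeg_ge2 e f v : e \in edges H -> f \in edges H -> f != e ->
  v \in e -> v \in f -> w e + w f <= wdeg w v.
Proof.
move=> eH fH fe ve vf; rewrite /wdeg (bigD1 e) ?eH //= lerD2l.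
by rewrite (bigD1 f) ?fH ?vf //= lerDl sumr_ge0.
Qed.

Lemma wdeg_ge3 e f g v :
  e \in edges H -> f \in edges H -> g \in edges H ->
  f != e -> g != e -> g != f -> v \in e -> v \in f -> v \in g ->
  w e + (w f + w g) <= wdeg w v.
Proof.
move=> eH fH gH fe ge gf ve vf vg; rewrite /wdeg (bigD1 e) ?eH //= lerD2l.
rewrite (bigD1 f) ?fH ?vf //= lerD2l.
by rewrite (bigD1 g) ?gH ?vg ?ge //= lerDl sumr_ge0.
Qed.
End WeightedDegree.

Lemma prod_setI_ge (R : realType) (T : finType) (A S : {set T}) (q : T -> R) a b :
    0 <= a -> 0 <= b ->
    (forall v, v \in A -> v \in S -> a <= q v) ->
    (forall v, v \in A -> v \notin S -> b <= q v) ->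
  a ^+ #|A :&: S| * b ^+ #|A :\: S| <= \prod_(v in A) q v.
Proof.
move=> a0 b0 qa qb; rewrite [leRHS](big_setID S) /= -!prodr_const.
apply: ler_pM; try by apply: prodr_ge0.
  by apply: ler_prod => v; rewrite inE => /andP[vA vS]; rewrite a0 qa.
by apply: ler_prod => v; rewrite inE => /andP[vS vA]; rewrite b0 qb.
Qed.

Lemma prod_setD1_ge (R : realType) (T : finType) (A : {set T}) z (q : T -> R) a b :
    0 <= a -> 0 <= b -> z \in A -> a <= q z ->
    (forall v, v \in A -> b <= q v) ->
  a * b ^+ #|A|.-1 <= \prod_(v in A) q v.
Proof.
move=> a0 b0 zA qa qb.
have := @prod_setI_ge R T A [set z] q a b a0 b0.
have -> : A :&: [set z] = [set z] by apply/setIidPr; rewrite sub1set.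
rewrite cards1 expr1 [#|A|](cardsD1 z) zA; apply=> [v _ /set1P->//|v vA _].
exact: qb.
Qed.

Lemma bernoulli_ineq (R : realType) (x : R) n :
  0 <= x -> 1 + x *+ n <= (1 + x) ^+ n.
Proof.
move=> x0; elim: n => [|n IH]; first by rewrite mulr0n addr0.
rewrite exprS mulrSr; apply: le_trans (ler_wpM2l _ IH); last by rewrite addr_ge0.
have : 0 <= x * (x *+ n) by rewrite mulr_ge0 ?mulrn_wge0.
lra.
Qed.

(** An edge meeting the core in [m] vertices counts as [m] edges meeting it
    once: Bernoulli's inequality makes the shared edge at least as good. *)
Lemma pow_shift_ge (R : realType) (t : R) m :
  (0 < m)%N -> 0 <= t -> (t + 1) * m%:R ^+ m <= (t + m%:R) ^+ m.
Proof.
move=> m0 t0; have M0 : 0 < m%:R :> R by rewrite ltr0n.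
have -> : t + m%:R = (1 + t / m%:R) * m%:R.
  by rewrite mulrDl mul1r mulfVK ?gt_eqF // addrC.
rewrite exprMn ler_wpM2r ?exprn_ge0 ?ler0n //.
apply: le_trans (bernoulli_ineq _ _); last by rewrite divr_ge0 // ltW.
by rewrite -[_ / _ *+ _]mulr_natr mulfVK ?gt_eqF // addrC.
Qed.

(** * Two edges sharing all but one vertex *)

(** Weight [1] on both edges gives degree [2] to each of the shared vertices. *)
Lemma spectral_radius_overlap (R : realType) r (H : hypergraph r) (c : R)
    (e f : {set H}) :
    0 < c -> c < 2 ^+ r.-1 -> (0 < r)%N ->
    e \in edges H -> f \in edges H -> e != f -> #|e :&: f| = r.-1 ->
  (r.-1)`!%:R * c `^ r%:R^-1 < spectral_radius R H.
Proof.
move=> c0 c2 r0 eH fH ef ef_r.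
pose w (d : {set H}) : R := if (d == e) || (d == f) then 1 else 0.
have w0 d : 0 <= w d by rewrite /w; case: ifP.
have we : w e = 1 by rewrite /w eqxx.
have wf : w f = 1 by rewrite /w eqxx orbT.
have half d d' : d \in edges H -> d' \in edges H -> d' != d -> w d = 1 ->
    w d' = 1 -> #|d :&: d'| = r.-1 -> 2 ^+ r.-1 <= \prod_(v in d) wdeg w v.
  move=> dH d'H dd' wd wd' dr; rewrite -dr.
  have := @prod_setI_ge R H d d' (wdeg w) 2 1 (ler0n _ 2) ler01.
  rewrite expr1n mulr1; apply=> v vd vd'; last by rewrite -wd wdeg_ge.
  by have := wdeg_ge2 w0 dH d'H dd' vd vd'; rewrite wd wd'.
apply: (@spectral_radius_gt R r H w c e r0 c0 w0 _ eH); last first.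
  rewrite we expr1n mulr1; apply: (lt_le_trans c2).
  by apply: (half e f) => //; rewrite eq_sym.
move=> d dH; have [->|de] := eqVneq d e.
  rewrite we expr1n mulr1; apply: (le_trans (ltW c2)).
  by apply: (half e f) => //; rewrite eq_sym.
have [->|df] := eqVneq d f.
  rewrite wf expr1n mulr1; apply: (le_trans (ltW c2)).
  by apply: (half f e) => //; rewrite setIC.
rewrite /w (negbTE de) (negbTE df) expr0n gtn_eqF // mulr0.
by apply: prodr_ge0 => v _; exact: wdeg_ge0.
Qed.

(** * The fan around an edge *)

Definition fan_weight (R : realType) r (H : hypergraph r) (t : R)
    (e0 e : {set H}) : R :=
  if e == e0 then t else #|e :&: e0|%:R.

Section Fan.
Variables (R : realType) (r : nat) (H : hypergraph r) (t : R) (e0 : {set H}).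
Hypotheses (r_gt0 : (0 < r)%N) (t_ge0 : 0 <= t) (e0H : e0 \in edges H).
Local Notation w := (fan_weight t e0).

Lemma fan_weight_ge0 e : 0 <= w e.
Proof. by rewrite /fan_weight; case: ifP. Qed.

Lemma fan_weight_center : w e0 = t.
Proof. by rewrite /fan_weight eqxx. Qed.

Lemma fan_weight_other e : e != e0 -> w e = #|e :&: e0|%:R.
Proof. by rewrite /fan_weight => /negbTE->. Qed.

Lemma fan_weight_ge1 e v : e != e0 -> v \in e -> v \in e0 -> 1 <= w e.
Proof.
move=> ee0 ve ve0; rewrite fan_weight_other // ler1n card_gt0.
by apply/set0Pn; exists v; rewrite inE ve.
Qed.

Lemma fan_wdeg_ge e v : e \in edges H -> e != e0 -> v \in e -> v \in e0 ->
  t + 1 <= wdeg w v.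
Proof.
move=> eH ee0 ve ve0.
apply: le_trans (wdeg_ge2 fan_weight_ge0 e0H eH ee0 ve0 ve).
by rewrite fan_weight_center lerD2l (fan_weight_ge1 ee0 ve).
Qed.

(** The [m] vertices of [e] in [e0] also carry the weight [t] of [e0], and the
    remaining ones carry at least the weight [m] of [e] itself. *)
Lemma fan_petal_le e : e \in edges H -> e != e0 ->
  (t + 1) * w e ^+ r <= \prod_(v in e) wdeg w v.
Proof.
move=> eH ee0; rewrite fan_weight_other //; set m := #|_|.
have [m0|m0] := posnP m.
  rewrite m0 expr0n gtn_eqF // mulr0.
  by apply: prodr_ge0 => v _; exact: wdeg_ge0 fan_weight_ge0 _.
have := @prod_setI_ge R H e e0 (wdeg w) (t + m%:R) m%:R.
rewrite addr_ge0 ?ler0n // => /(_ isT isT) pr.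
apply: le_trans (pr _ _) => [|v ve ve0|v ve _].
- rewrite -/m -{1}(edges_uniform eH) -(cardsID e0 e) -/m exprD mulrA.
  by rewrite ler_wpM2r ?exprn_ge0 ?pow_shift_ge.
- have := wdeg_ge2 fan_weight_ge0 e0H eH ee0 ve0 ve.
  by rewrite fan_weight_center fan_weight_other.
- have := wdeg_ge fan_weight_ge0 eH ve.
  by rewrite fan_weight_other.
Qed.

(** With [t + 1] in place of [c] the edges other than [e0] meet their inequality
    whatever their overlaps, which leaves one numerical condition at [e0]. *)
Lemma spectral_radius_fan : (t + 1) * t ^+ r < \prod_(v in e0) wdeg w v ->
  (r.-1)`!%:R * (t + 1) `^ r%:R^-1 < spectral_radius R H.
Proof.
move=> tr; apply: (@spectral_radius_gt R r H w (t + 1) e0) => //.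
- by rewrite ltr_wpDl.
- exact: fan_weight_ge0.
- move=> e eH; have [->|] := eqVneq e e0; last exact: fan_petal_le.
  by rewrite fan_weight_center ltW.
- by rewrite fan_weight_center.
Qed.
End Fan.

(** * Numerical inequalities *)

Section Sqrt5.
Variable R : realType.
Local Notation s := (Num.sqrt 5 : R).

Lemma sqrt5_sqr : s ^+ 2 = 5. Proof. by rewrite sqr_sqrtr. Qed.

Lemma sqrt5_gt2 : 2 < s.
Proof.
rewrite -(@ltr_pXn2r R 2) ?nnegrE ?sqrtr_ge0 // sqrt5_sqr; lra.
Qed.

Lemma sqrt5_lt3 : s < 3.
Proof.
rewrite -(@ltr_pXn2r R 2) ?nnegrE ?sqrtr_ge0 // sqrt5_sqr; lra.
Qed.

Lemma sqrt5_core6 r : (6 <= r)%N -> (1 + s) ^+ r < (2 + s) ^+ r.-1.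
Proof.
have s2 := sqrt5_sqr; have sg := sqrt5_gt2.
elim: r => // r IH; rewrite ltnS leq_eqVlt => /orP[/eqP<-/=|r6].
  have -> : (1 + s) ^+ 6 = 576 + 256 * s by ring: s2.
  have -> : (2 + s) ^+ 5 = 682 + 305 * s by ring: s2.
  lra.
case: r r6 IH => // r r6 /(_ r6) IH; rewrite exprS [ltRHS]exprS.
have c0 : 0 <= 1 + s by lra.
apply: ltr_pM => //; [exact: exprn_ge0 | lra].
Qed.

Lemma sqrt5_crowded5 : (2 + s) * (1 + s) ^+ 5 < (3 + s) * (2 + s) ^+ 4.
Proof.
have s2 := sqrt5_sqr; have sg := sqrt5_gt2.
have -> : (2 + s) * (1 + s) ^+ 5 = 752 + 336 * s by ring: s2.
have -> : (3 + s) * (2 + s) ^+ 4 = 843 + 377 * s by ring: s2.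
lra.
Qed.

Lemma sqrt5_tail5 : s * (1 + s) ^+ 3 < (2 + s) ^+ 3.
Proof.
have s2 := sqrt5_sqr; have sg := sqrt5_gt2.
have -> : s * (1 + s) ^+ 3 = 40 + 16 * s by ring: s2.
have -> : (2 + s) ^+ 3 = 38 + 17 * s by ring: s2.
lra.
Qed.

Lemma sqrt5_star5 : (2 + s) ^+ 4 <= (1 + s) ^+ 5.
Proof.
have s2 := sqrt5_sqr; have sg := sqrt5_gt2.
have -> : (2 + s) ^+ 4 = 161 + 72 * s by ring: s2.
have -> : (1 + s) ^+ 5 = 176 + 80 * s by ring: s2.
lra.
Qed.
End Sqrt5.

(** * A tail of length two at a core of size five *)

Section Tail.
Variables (R : realType) (H : hypergraph 5) (e0 F G : {set H}) (v z : H).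
Local Notation s := (Num.sqrt 5 : R).
Hypotheses (e0H : e0 \in edges H) (FH : F \in edges H) (GH : G \in edges H).
Hypotheses (Fe0 : F != e0) (Ge0 : G != e0) (GF : G != F).
Hypotheses (vF : v \in F) (ve0 : v \in e0) (zF : z \in F) (zG : z \in G).
Hypothesis zv : z != v.
Hypothesis e0_nonleaf : forall u, u \in e0 ->
  exists2 e, e \in edges H & (e != e0) && (u \in e).

(** Weights making the inequality tight at [F], at [G] when it avoids [e0], and
    at the other edges at [e0] on the tree with edges [e0], its five neighbours
    and [G].  All edges meeting [F] or [e0], and not only [G], receive a weight,
    so that [G] may be an arbitrary edge, one through [e0] included. *)
Let w (e : {set H}) : R :=
  if e == e0 then 1 + s else if e == F then (1 + s) / s
  else if [disjoint e & e0] then if [disjoint e & F] then 0 else s^-1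
  else 1.

Lemma spectral_radius_tail :
  4`!%:R * (2 + s) `^ 5%:R^-1 < spectral_radius R H.
Proof.
have sg := sqrt5_gt2 R; have sl := sqrt5_lt3 R; have s2 := sqrt5_sqr R.
have s0 : 0 < s by lra.
have sn0 : s != 0 by rewrite gt_eqF.
have V0 : 0 < s^-1 by rewrite invr_gt0.
have V1 : s^-1 <= 1 by rewrite invf_le1 //; lra.
have p1 : 1 <= (1 + s) / s by rewrite ler_pdivlMr // mul1r; lra.
have w0 e : 0 <= w e by rewrite /w; repeat (case: ifP => _); lra.
have we0 : w e0 = 1 + s by rewrite /w eqxx.
have wF : w F = (1 + s) / s by rewrite /w eqxx (negbTE Fe0).
have w_meets e u : e != e0 -> u \in e -> u \in e0 -> 1 <= w e.
  move=> ee0 ue ue0; rewrite /w (negbTE ee0); case: ifP => // _.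
  by case: ifP => // /pred0P/(_ u); rewrite /= ue ue0.
have w_touch e u : e != e0 -> u \in e -> u \in F -> s^-1 <= w e.
  move=> ee0 ue uF; rewrite /w (negbTE ee0); case: ifP => _; first lra.
  case: ifP => // _; case: ifP => // /pred0P/(_ u); by rewrite /= ue uF.
have q0 u : 0 <= wdeg w u by exact: wdeg_ge0.
have q_e0 u : u \in e0 -> 2 + s <= wdeg w u.
  move=> ue0; have [e eH /andP[ee0 ue]] := e0_nonleaf ue0.
  have := wdeg_ge2 w0 e0H eH ee0 ue0 ue; have := w_meets _ _ ee0 ue ue0.
  rewrite we0; lra.
have q_v : (1 + s) ^+ 2 / s <= wdeg w v.
  have := wdeg_ge2 w0 e0H FH Fe0 ve0 vF; rewrite we0 wF.
  by have -> : 1 + s + (1 + s) / s = (1 + s) ^+ 2 / s by field.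
have e0_lt : (2 + s) * w e0 ^+ 5 < \prod_(u in e0) wdeg w u.
  apply: lt_le_trans (prod_setD1_ge _ _ ve0 q_v q_e0); last lra.
    2: by rewrite divr_ge0 ?sqr_ge0 // ltW.
  rewrite we0 (edges_uniform e0H) /=.
  have := sqrt5_tail5 R; set A := (2 + s) ^+ 3; set B := (1 + s) ^+ 3 => AB.
  have -> : (1 + s) ^+ 2 / s * (2 + s) ^+ 4
    = (1 + s) ^+ 2 * (2 + s) * (A / s) by rewrite /A; field.
  have -> : (2 + s) * (1 + s) ^+ 5 = (1 + s) ^+ 2 * (2 + s) * B.
    by rewrite /B; ring.
  rewrite ltr_pM2l ?ltr_pdivlMr ?(mulrC B) //.
  by rewrite mulr_gt0 ?exprn_gt0 //; lra.
apply: (@spectral_radius_gt R 5 H w (2 + s) e0) => //; first lra.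
move=> e eH; have [->|ee0] := eqVneq e e0; first exact: ltW.
have [->|eF] := eqVneq e F.
  (* Only here does the edge [G] matter: it lifts the degree at [z]. *)
  have q_z : (2 + s) / s <= wdeg w z.
    have := wdeg_ge2 w0 FH GH GF zF zG; rewrite wF.
    have := w_touch _ _ Ge0 zG zF.
    have -> : (2 + s) / s = (1 + s) / s + s^-1 by field.
    lra.
  have q_F u : u \in F -> (1 + s) / s <= wdeg w u.
    by move=> uF; rewrite -wF wdeg_ge.
  have zFv : z \in F :\ v by rewrite !inE zv.
  have Fv4 : #|F :\ v| = 4.
    by have := cardsD1 v F; rewrite vF (edges_uniform FH) => -[].
  rewrite wF (big_setD1 v vF) /=.
  have p0 : 0 <= (1 + s) / s by lra.
  have c0 : 0 <= (2 + s) / s by rewrite divr_ge0 //; lra.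
  have := @prod_setD1_ge R H (F :\ v) z (wdeg w) _ _ c0 p0 zFv q_z.
  rewrite Fv4 => /(_ (fun u uF => q_F u (fintype.subsetP (subD1set F v) u uF))) pr.
  apply: le_trans (ler_pM _ _ q_v pr).
  - suff -> : (2 + s) * ((1 + s) / s) ^+ 5
      = (1 + s) ^+ 2 / s * ((2 + s) / s * ((1 + s) / s) ^+ 3) by [].
    by field.
  - by rewrite divr_ge0 ?sqr_ge0 // ltW.
  - by rewrite mulr_ge0 ?exprn_ge0.
have [de0|] := boolP [disjoint e & e0].
  have [dF|/pred0Pn[u /andP[ue uF]]] := boolP [disjoint e & F].
    have -> : w e = 0 by rewrite /w (negbTE ee0) (negbTE eF) de0 dF.
    by rewrite expr0n mulr0 prodr_ge0.
  have we : w e = s^-1.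
    rewrite /w (negbTE ee0) (negbTE eF) de0 ifN //.
    by apply/pred0Pn; exists u; apply/andP.
  have q_e x : x \in e -> s^-1 <= wdeg w x by move=> xe; rewrite -we wdeg_ge.
  have q_u : (2 + s) / s <= wdeg w u.
    have := wdeg_ge2 w0 FH eH eF uF ue; rewrite we wF.
    have -> : (2 + s) / s = (1 + s) / s + s^-1 by field.
    by [].
  apply: le_trans (prod_setD1_ge _ _ ue q_u q_e); rewrite ?divr_ge0 //; try lra.
  by rewrite we (edges_uniform eH) /= exprS -mulrA.
move=> de0; have we : w e = 1.
  by rewrite /w (negbTE ee0) (negbTE eF) (negbTE de0).
have /pred0Pn[u /andP[ue ue0]] := de0.
have q_e x : x \in e -> 1 <= wdeg w x by move=> xe; rewrite -we wdeg_ge.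
apply: le_trans (prod_setD1_ge _ _ ue (q_e0 u ue0) q_e) => //; last lra.
by rewrite we !expr1n.
Qed.
End Tail.

(** * Leaves and reducibility *)

Section Reducibility.
Variables (r : nat) (H : hypergraph r).

Lemma isomorphic_sym s (K : hypergraph s) (g : K -> H) : bijective g ->
  edges H = [set g @: e | e : {set K} in edges K] -> isomorphic H K.
Proof.
case=> f gK fK EH; exists f; first by exists g.
rewrite EH; apply/setP => e; apply/idP/imsetP => [eK|[_ /imsetP[d dK ->] ->]].
  exists (g @: e); first exact: imset_f.
  by rewrite -imset_comp (eq_imset _ gK) imset_id.
by rewrite -imset_comp (eq_imset _ gK) imset_id.
Qed.

(** In an extension the vertex added to an edge is a leaf of that edge. *)
Lemma reducible_leaf (e : {set H}) : reducible H -> e \in edges H ->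
  exists2 v, v \in e & forall e', e' \in edges H -> v \in e' -> e' = e.
Proof.
case=> H' [f fbij EK] eH.
have inj_f := bij_inj fbij.
have : f @: e \in edges (extension H') by rewrite EK imset_f.
case/imsetP => d _ fe.
have : (inr d : ext_vertices H') \in f @: e by rewrite fe setU11.
case/imsetP => v ve dv; exists v => // e' e'H ve'.
have : f @: e' \in edges (extension H') by rewrite EK imset_f.
case/imsetP => d' _ fe'.
have : f v \in f @: e' by rewrite imset_f.
rewrite -dv fe' => /setU1P[[dd']|/imsetP[] //].
by apply: (imset_inj inj_f); rewrite fe fe' dd'.
Qed.

(** Choose a leaf in each edge and delete these leaves.  The shrunken edges
    remain distinct because no two edges share [r - 1] vertices, so putting the
    leaves back is an extension. *)
Lemma leaves_reducible :
  (forall e, e \in edges H ->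
    exists2 v, v \in e & forall e', e' \in edges H -> v \in e' -> e' = e) ->
  (forall e f, e \in edges H -> f \in edges H -> e != f ->
    #|e :&: f| != r.-1) ->
  reducible H.
Proof.
move=> leafH overlapH.
pose eT : finType := {e : {set H} | e \in edges H}.
have leafP (d : eT) : exists v, (v \in val d) &&
    [forall e in edges H, (v \in e) ==> (e == val d)].
  have [v vd v_leaf] := leafH _ (valP d); exists v; rewrite vd /=.
  by apply/forall_inP => e eH; apply/implyP => /(v_leaf _ eH)->.
pose l d := xchoose (leafP d).
have le d : l d \in val d by have /andP[] := xchooseP (leafP d).
have l_leaf d e : e \in edges H -> l d \in e -> e = val d.
  have /andP[_ /forall_inP lP] := xchooseP (leafP d).
  by move=> eH; have /implyP lPe := lP e eH => /lPe/eqP.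
pose L := [set l d | d : eT].
pose V' : finType := {v : H | v \notin L}.
pose rst (d : eT) : {set V'} := [set u | val u \in val d].
have eL d : val d :\ l d = val @: rst d.
  apply/setP => u; apply/setD1P/imsetP => [[ul ue]|[u' u'e ->]].
    have uL : u \notin L.
      apply: contraNN ul => /imsetP[d' _ ud']; rewrite ud' in ue *.
      by rewrite (_ : d = d') //; apply/val_inj/(l_leaf d'); rewrite ?(valP d).
    by exists (Sub u uL); rewrite ?inE SubK.
  rewrite inE in u'e; split=> //; apply: contraNneq (valP u') => ->.
  exact: imset_f.
have cardrst d : #|rst d| = r.-1.
  rewrite -(card_imset _ val_inj) -eL.
  have := cardsD1 (l d) (val d).
  by rewrite le (edges_uniform (valP d)) => /(congr1 predn)->.
pose E' : {set {set V'}} := [set rst d | d : eT].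
have E'_unif e : e \in E' -> #|e| = r.-1 by case/imsetP => d _ ->.
have rst_inj : injective rst.
  move=> d d' dd'; apply: val_inj; apply/eqP; apply: contraT => nd.
  have := overlapH _ _ (valP d) (valP d') nd; rewrite -(cardrst d).
  suff -> : val d :&: val d' = val @: rst d.
    by rewrite card_imset ?eqxx //; exact: val_inj.
  apply/setP => u; rewrite inE; apply/andP/idP => [[ud ud']|ur].
    rewrite -eL in_setD1 ud andbT; apply: contraNneq nd => ul.
    by rewrite eq_sym; apply/eqP; apply: l_leaf; rewrite -?ul ?(valP d').
  by split; [move: ur | move: ur; rewrite dd']; rewrite -eL => /setD1P[].
pose H' := Hypergraph E'_unif; exists H'.
have liftP (x : {e : {set H'} | e \in edges H'}) : exists d, rst d == val x.
  by case: x => /= x /imsetP[d _ ->]; exists d.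
(* The edge of [H] that shrinks to a given edge of [H']. *)
pose lft x := xchoose (liftP x).
have lftK x : rst (lft x) = val x by exact/eqP/(xchooseP (liftP x)).
have rstH d : rst d \in edges H' by exact: imset_f.
have lft_rst d : lft (exist _ (rst d) (rstH d)) = d.
  by apply: rst_inj; rewrite lftK.
pose g (x : extension H') : H :=
  match x with inl u => val u | inr x => l (lft x) end.
apply: (@isomorphic_sym _ _ g).
  have g_inj : injective g.
    move=> [u|x] [u'|x'] /= guu.
    - by congr inl; apply: val_inj.
    - by have := valP u; rewrite /= guu imset_f.
    - by have := valP u'; rewrite /= -guu imset_f.
    - congr inr; apply: val_inj; rewrite -!lftK; congr rst; apply: val_inj.
      by apply: l_leaf; rewrite ?(valP (lft x)) // -guu le.
  have g_surj v : exists x, g x == v.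
    have [/imsetP[d _ ->]|vL] := boolP (v \in L).
      by exists (inr (exist _ (rst d) (rstH d))); rewrite /= lft_rst.
    by exists (inl (Sub v vL)); rewrite /=.
  exists (fun v => xchoose (g_surj v)).
    by move=> x; apply: g_inj; apply/eqP; exact: (xchooseP (g_surj (g x))).
  by move=> v; apply/eqP; exact: (xchooseP (g_surj v)).
have gE (x : {e : {set H'} | e \in edges H'}) :
    g @: ((inr x : ext_vertices H') |: [set (inl v : ext_vertices H') | v in val x])
    = val (lft x).
  rewrite imsetU1 -imset_comp /= -lftK.
  have -> : [set (g \o (fun v : H' => inl v : ext_vertices H')) v
               | v in rst (lft x)] = val @: rst (lft x) by apply: eq_imset.
  by rewrite -eL setD1K.
apply/setP => e; apply/idP/imsetP => [eH|[_ /imsetP[x _ ->] ->]].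
  pose x := exist (fun e => e \in edges H') (rst (Sub e eH)) (rstH _).
  exists ((inr x : ext_vertices H') |: [set (inl v : ext_vertices H') | v in val x]).
    exact: imset_f.
  by rewrite gE lft_rst SubK.
by rewrite gE (valP (lft x)).
Qed.
End Reducibility.

(** * Cores of irreducible hypergraphs *)

Definition edge_core r (H : hypergraph r) (e0 : {set H}) : Prop :=
  e0 \in edges H /\
  forall v, v \in e0 -> exists2 e, e \in edges H & (e != e0) && (v \in e).

Lemma irreducible_core (R : realType) r (H : hypergraph r) : (5 <= r)%N ->
  irreducible H ->
  spectral_radius R H <= (r.-1)`!%:R * (2 + Num.sqrt 5) `^ r%:R^-1 ->
  exists e0 : {set H}, edge_core e0.
Proof.
move=> r5 irrH rhoH; apply: contrapT => no_core; apply: irrH.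
have sg := sqrt5_gt2 R; have sl := sqrt5_lt3 R.
apply: leaves_reducible => [e eH|e f eH fH ef].
  apply: contrapT => no_leaf; apply: no_core; exists e; split=> // v ve.
  apply: contrapT => v_leaf; apply: no_leaf; exists v => // f fH vf.
  apply/eqP; apply: contraT => fe; case: v_leaf; exists f => //.
  by rewrite fe.
apply/eqP => ef_r; move: rhoH; rewrite leNgt => /negP[].
apply: (@spectral_radius_overlap R r H _ e f) => //; first lra.
  apply: (@lt_le_trans _ _ (2 ^+ 4)); first lra.
  by rewrite ler_weXn2l ?ler1n // -ltnS prednK ?(leq_trans _ r5).
exact: leq_trans r5.
Qed.

Section Core.
Variables (R : realType) (r : nat) (H : hypergraph r) (e0 : {set H}).
Local Notation s := (Num.sqrt 5 : R).
Local Notation w := (fan_weight (1 + s) e0).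
Hypotheses (r_gt0 : (0 < r)%N) (core : edge_core e0).

Lemma core_wdeg_ge v : v \in e0 -> 2 + s <= wdeg w v.
Proof.
have [e0H e0P] := core; move=> ve0; have [e eH /andP[ee0 ve]] := e0P v ve0.
have -> : 2 + s = 1 + s + 1 by ring.
by apply: fan_wdeg_ge ve ve0 => //; have := sqrt5_gt2 R; lra.
Qed.

Lemma spectral_radius_core : (2 + s) * (1 + s) ^+ r < \prod_(v in e0) wdeg w v ->
  (r.-1)`!%:R * (2 + s) `^ r%:R^-1 < spectral_radius R H.
Proof.
have [e0H _] := core; have -> : 2 + s = 1 + s + 1 by ring.
by apply: spectral_radius_fan => //; have := sqrt5_gt2 R; lra.
Qed.
End Core.

Lemma core_spectral_radius6 (R : realType) r (H : hypergraph r) (e0 : {set H}) :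
  (6 <= r)%N -> edge_core e0 ->
  (r.-1)`!%:R * (2 + Num.sqrt 5) `^ r%:R^-1 < spectral_radius R H.
Proof.
move=> r6 core; have r0 : (0 < r)%N by exact: leq_trans r6.
have sg := sqrt5_gt2 R.
apply: (spectral_radius_core r0 core).
apply: (@lt_le_trans _ _ ((2 + Num.sqrt 5) ^+ r)).
  rewrite -[in ltRHS](prednK r0) exprS ltr_pM2l; last lra.
  exact: sqrt5_core6.
rewrite -[in leLHS](edges_uniform core.1) -prodr_const.
apply: ler_prod => v ve0; rewrite core_wdeg_ge // andbT; lra.
Qed.

(** * Five-uniform hypergraphs with a core *)

Section FiveUniform.
Variables (R : realType) (H : hypergraph 5) (e0 : {set H}).
Local Notation s := (Num.sqrt 5 : R).
Local Notation w := (fan_weight (1 + s) e0).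
Hypotheses (core : edge_core e0) (connH : hconnected H).
Hypothesis rhoH : spectral_radius R H <= 4`!%:R * (2 + s) `^ 5%:R^-1.

Let e0H : e0 \in edges H. Proof. exact: core.1. Qed.

Let s_gt0 : 0 <= 1 + s. Proof. by have := sqrt5_gt2 R; lra. Qed.

(** One unit of weight more than [core_wdeg_ge] guarantees, at a single vertex,
    already pushes the fan over the threshold.  The two lemmas that follow turn
    this into structure: such a unit comes from a second edge at [v], or from a
    second vertex of the core on the edge at [v]. *)
Lemma core_wdeg_lt v : v \in e0 -> wdeg w v < 3 + s.
Proof.
move=> ve0; rewrite ltNge; apply/negP => q3.
move: rhoH; rewrite leNgt => /negP[]; apply: (@spectral_radius_core R 5 H e0) => //.
have sg := sqrt5_gt2 R.
have := @prod_setD1_ge R H e0 v (wdeg w) (3 + s) (2 + s) _ _ ve0 q3.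
rewrite (edges_uniform e0H) => pr; apply: lt_le_trans (sqrt5_crowded5 R) (pr _ _ _).
- lra.
- lra.
- by move=> u; exact: core_wdeg_ge.
Qed.

Lemma core_edge_unique e f v : e \in edges H -> f \in edges H ->
  e != e0 -> f != e0 -> v \in e0 -> v \in e -> v \in f -> e = f.
Proof.
move=> eH fH ee0 fe0 ve0 ve vf; apply/eqP; apply: contraT => ef.
have := core_wdeg_lt ve0; rewrite ltNge => /negP[].
apply: le_trans (wdeg_ge3 (fan_weight_ge0 e0 s_gt0) e0H eH fH ee0 fe0 _ ve0 ve vf).
  rewrite fan_weight_center.
  by have := fan_weight_ge1 (1 + s) ee0 ve ve0;
     have := fan_weight_ge1 (1 + s) fe0 vf ve0; lra.
by rewrite eq_sym.
Qed.

Lemma core_edge_meet e u v : e \in edges H -> e != e0 ->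
  u \in e0 -> v \in e0 -> u \in e -> v \in e -> u = v.
Proof.
move=> eH ee0 ue0 ve0 ue ve; apply/eqP; apply: contraT => uv.
have := core_wdeg_lt ve0; rewrite ltNge => /negP[].
apply: le_trans (wdeg_ge2 (fan_weight_ge0 e0 s_gt0) e0H eH ee0 ve0 ve).
rewrite fan_weight_center fan_weight_other //.
suff : 2 <= #|e :&: e0|%:R :> R by lra.
have /subset_leq_card : [set u; v] \subset e :&: e0.
  by apply/fintype.subsetP => x; rewrite !inE => /orP[]/eqP->; apply/andP.
by rewrite cards2 uv ler_nat.
Qed.

(** A further edge through a vertex of [e] forms a tail when that vertex is
    outside the core, and contradicts [core_edge_unique] when it is in it. *)
Lemma core_petal_isolated e f v z : e \in edges H -> f \in edges H ->
  e != e0 -> f != e0 -> v \in e0 -> v \in e -> z \in e -> z \in f -> f = e.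
Proof.
move=> eH fH ee0 fe0 ve0 ve ze zf; apply/eqP; apply: contraT => fe.
have [zv|zv] := eqVneq z v.
  have vf : v \in f by rewrite -zv.
  by move: fe; rewrite (core_edge_unique fH eH fe0 ee0 ve0 vf ve) eqxx.
move: rhoH; rewrite leNgt => /negP[].
exact: (@spectral_radius_tail R H e0 e f v z e0H eH fH ee0 fe0 fe ve ve0 ze zf zv core.2).
Qed.

(** The vertex [(i, j)] of the star goes to the [j]-th vertex of the edge at the
    [i]-th vertex of [e0], that vertex of [e0] itself being listed first. *)
Lemma core_star : isomorphic H five_edge_star.
Proof.
have [v0 v0e0] : exists v, v \in e0.
  by apply/card_gt0P; rewrite (edges_uniform e0H).
pose en (i : 'I_5) := nth v0 (enum e0) i.
have sz : size (enum e0) = 5%N by rewrite -cardE (edges_uniform e0H).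
have en_e0 i : en i \in e0 by rewrite -mem_enum mem_nth ?sz.
have en_inj : injective en.
  by move=> i j /eqP; rewrite nth_uniq ?sz ?enum_uniq // => /eqP/val_inj.
have en_surj v : v \in e0 -> exists i, v = en i.
  rewrite -mem_enum => /(nthP v0)[i]; rewrite sz => i5 <-.
  by exists (Ordinal i5).
have Fex (i : 'I_5) : exists e, [&& e \in edges H, e != e0 & en i \in e].
  by have [e eH /andP[ee0 ve]] := core.2 _ (en_e0 i); exists e; apply/and3P.
pose F i := xchoose (Fex i).
have FH i : F i \in edges H by have /and3P[] := xchooseP (Fex i).
have Fe0 i : F i != e0 by have /and3P[] := xchooseP (Fex i).
have enF i : en i \in F i by have /and3P[] := xchooseP (Fex i).
have F_isol i e z : e \in edges H -> e != e0 -> z \in F i -> z \in e -> e = F i.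
  by move=> eH ee0; exact: core_petal_isolated (en_e0 i) (enF i).
pose Fs i := en i :: enum (F i :\ en i).
have Fs_mem i z : (z \in Fs i) = (z \in F i).
  by rewrite inE mem_enum in_setD1; case: eqVneq => //= ->; rewrite enF.
have Fs_uniq i : uniq (Fs i) by rewrite /= mem_enum setD11 enum_uniq.
have Fs_size i : size (Fs i) = 5%N.
  rewrite /= -cardE.
  by have := cardsD1 (en i) (F i); rewrite enF (edges_uniform (FH i)) => /esym.
pose g (x : five_edge_star) : H := nth v0 (Fs x.1) x.2.
have gF i j : g (i, j) \in F i by rewrite -Fs_mem mem_nth ?Fs_size.
have g0 i : g (i, ord0) = en i by [].
have g_inj : injective g.
  move=> [i j] [i' j'] gg.
  have FF : F i' = F i by apply: F_isol (gF i j) _ => //; rewrite gg.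
  have ii' : i = i'.
    apply: en_inj; apply: (@core_edge_meet (F i)) => //.
    by rewrite -FF.
  rewrite -ii' in gg *; congr pair; apply/val_inj/eqP.
  move/eqP: gg; rewrite /g [(i, j).1]/= [(i, j').1]/= [(i, j).2]/= [(i, j').2]/=.
  by rewrite (nth_uniq v0 _ _ (Fs_uniq i)) ?Fs_size ?ltn_ord.
have F_surj i z : z \in F i -> exists j, z = g (i, j).
  rewrite -Fs_mem => /(nthP v0)[j]; rewrite Fs_size => j5 <-.
  by exists (Ordinal j5).
have cover z : exists i, z \in F i.
  pose U := [pred z : H | [exists i, z \in F i]].
  have adj_sym : symmetric (@adjacent _ H).
    by move=> x y; apply: eq_existsb => e; rewrite [(x \in e) && _]andbC.
  have U_closed : closed (@adjacent _ H) U.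
    apply: (intro_closed (sym_connect_sym adj_sym)) => x y.
    case/exists_inP => e eH /andP[xe ye] /existsP[i xF]; apply/existsP.
    have [ee0|ee0] := eqVneq e e0.
      by rewrite ee0 in ye; have [k ->] := en_surj _ ye; exists k.
    by exists i; rewrite -(F_isol i e x).
  have v0U : v0 \in U by apply/existsP; have [k ->] := en_surj _ v0e0; exists k.
  by apply/existsP; move: v0U; rewrite (closed_connect U_closed (connH v0 z)).
have g_bij : bijective g.
  have g_surj z : exists x, g x == z.
    by have [i /F_surj[j ->]] := cover z; exists (i, j).
  exists (fun z => xchoose (g_surj z)).
    by move=> x; apply: g_inj; apply/eqP; exact: (xchooseP (g_surj (g x))).
  by move=> z; apply/eqP; exact: (xchooseP (g_surj z)).
apply: (isomorphic_sym g_bij).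
have g_center : g @: star_center = e0.
  apply/setP => z; apply/imsetP/idP => [[_ /imsetP[i _ ->] ->]|ze0].
    by rewrite g0.
  by have [i ->] := en_surj _ ze0; exists (i, ord0) => //; apply: imset_f.
have g_outer i : g @: star_outer i = F i.
  apply/setP => z; apply/imsetP/idP => [[_ /imsetP[j _ ->] ->]|zF].
    exact: gF.
  by have [j ->] := F_surj _ _ zF; exists (i, j) => //; apply: imset_f.
apply/setP => e; apply/idP/imsetP => [eH|[_ /setU1P[->|/imsetP[i _ ->]] ->]].
- have [->|ee0] := eqVneq e e0.
    by exists star_center; rewrite ?setU11 ?g_center.
  have /card_gt0P[z ze] : (0 < #|e|)%N by rewrite (edges_uniform eH).
  have [i zF] := cover z; exists (star_outer i).
    by apply/setU1P; right; apply: imset_f.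
  by rewrite g_outer; apply: F_isol zF ze.
- by rewrite g_center.
- by rewrite g_outer.
Qed.
End FiveUniform.

(** * The five edge-star *)

Lemma mem_star_center i j : ((i, j) \in star_center) = (j == ord0).
Proof.
apply/imsetP/eqP => [[k _ [_ ->]]//|->]; by exists i.
Qed.

Lemma mem_star_outer k i j : ((i, j) \in star_outer k) = (i == k).
Proof.
apply/imsetP/eqP => [[l _ [-> _]]//|->]; by exists j.
Qed.

Lemma star_center_edge : star_center \in edges five_edge_star.
Proof. exact: setU11. Qed.

Lemma star_outer_edge i : star_outer i \in edges five_edge_star.
Proof. by apply/setU1P; right; exact: imset_f. Qed.

Lemma star_outer_neq_center i : star_outer i != star_center.
Proof.
apply/eqP => /setP/(_ (i, lift ord0 ord0)).
by rewrite mem_star_outer mem_star_center eqxx.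
Qed.

Lemma star_irreducible : irreducible five_edge_star.
Proof.
move=> /reducible_leaf/(_ star_center_edge)[[i j]].
rewrite mem_star_center => /eqP-> /(_ _ (star_outer_edge i)).
rewrite mem_star_outer eqxx => /(_ isT)/eqP.
by rewrite (negbTE (star_outer_neq_center i)).
Qed.

Lemma star_connected : hconnected five_edge_star.
Proof.
have adj e (x y : five_edge_star) : e \in edges five_edge_star ->
    x \in e -> y \in e -> connect (@adjacent _ five_edge_star) x y.
  by move=> eH xe ye; apply/connect1/exists_inP; exists e => //; apply/andP.
have outer i j j' : connect (@adjacent _ five_edge_star) (i, j) (i, j').
  by apply: adj (star_outer_edge i) _ _; rewrite mem_star_outer.
move=> [i j] [i' j']; apply: connect_trans (outer i j ord0) _.
apply: connect_trans (outer i' ord0 j').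
by apply: adj star_center_edge _ _; rewrite mem_star_center.
Qed.

(** A vertex of the centre gives the share [1 / c] to its outer edge and
    [1 - 1 / c] to the centre; the outer edges then have product exactly [1 / c],
    and the centre has [(1 - 1 / c)^5 >= 1 / c]. *)
Lemma star_spectral_radius (R : realType) :
  spectral_radius R five_edge_star <= 4`!%:R * (2 + Num.sqrt 5) `^ 5%:R^-1.
Proof.
set s := Num.sqrt 5; have sg : 2 < s := sqrt5_gt2 R.
have c0 : 0 < 2 + s by lra.
pose B (v : five_edge_star) (e : {set five_edge_star}) : R :=
  if e == star_center then (1 + s) / (2 + s)
  else if v.2 == ord0 then (2 + s)^-1 else 1.
apply: (@spectral_radius_le R 5 five_edge_star B) => //.
- exact: ltW.
- move=> e v; rewrite /B; case: ifP => _; first by rewrite divr_ge0 //; lra.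
  by case: ifP; rewrite // invr_ge0 ltW.
- move=> [i j].
  have edgeP e : (e \in edges five_edge_star) && ((i, j) \in e)
      = (e == star_outer i) || (e == star_center) && (j == ord0).
    apply/andP/orP => [[/setU1P[->|/imsetP[k _ ->]]]|[/eqP->|/andP[/eqP-> j0]]].
    - by rewrite mem_star_center eqxx; right.
    - by rewrite mem_star_outer => /eqP->; left.
    - by rewrite star_outer_edge mem_star_outer.
    - by rewrite star_center_edge mem_star_center.
  have Bo : B (i, j) (star_outer i) = if j == ord0 then (2 + s)^-1 else 1.
    by rewrite /B (negbTE (star_outer_neq_center i)).
  have [j0|j0] := boolP (j == ord0); last first.
    rewrite (big_pred1 (star_outer i)) ?Bo ?(negbTE j0) // => e.
    by rewrite edgeP (negbTE j0) andbF orbF.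
  rewrite (bigD1 star_center) /=; last by rewrite edgeP eqxx j0 orbT.
  rewrite (big_pred1 (star_outer i)) => [|e].
    rewrite Bo j0 {1}/B eqxx -[X in _ + X]mul1r -mulrDl.
    by rewrite ler_pdivrMr // mul1r; lra.
  rewrite edgeP j0 andbT; have [->|/negbTE eo] := eqVneq e (star_outer i).
    by rewrite star_outer_neq_center /= eqxx.
  by rewrite /= andbN eo.
- move=> e /setU1P[->|/imsetP[i _ ->]].
    rewrite (eq_bigr (fun=> (1 + s) / (2 + s))); last first.
      by move=> v _; rewrite /B eqxx.
    rewrite prodr_const (edges_uniform star_center_edge) expr_div_n.
    rewrite mulrA ler_pdivlMr ?exprn_gt0 // mul1r exprS.
    apply: ler_wpM2l (sqrt5_star5 R); exact: ltW.
  rewrite big_imset /=; last by move=> ? ? _ _ [].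
  rewrite big_ord_recl /= big1 => [|j _].
    by rewrite /B (negbTE (star_outer_neq_center i)) eqxx mulr1 divff ?gt_eqF.
  by rewrite /B (negbTE (star_outer_neq_center i)).
Qed.

(** * Classification *)

Theorem theorem3 (R : realType) :
  [/\ [/\ irreducible five_edge_star, hconnected five_edge_star
        & spectral_radius R five_edge_star
            <= (4`!)%:R * (2 + Num.sqrt 5) `^ 5%:R^-1],
      (forall H : hypergraph 5,
         irreducible H -> hconnected H ->
         spectral_radius R H <= (4`!)%:R * (2 + Num.sqrt 5) `^ 5%:R^-1 ->
         isomorphic H five_edge_star)
    & (forall (r : nat) (H : hypergraph r),
         (6 <= r)%N ->
         spectral_radius R H <= ((r.-1)`!)%:R * (2 + Num.sqrt 5) `^ r%:R^-1 ->
         reducible H)].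
Proof.
split.
- split; [exact: star_irreducible | exact: star_connected |].
  exact: star_spectral_radius.
- move=> H irrH connH rhoH.
  have [e0 core] := irreducible_core (leqnn 5) irrH rhoH.
  exact: core_star core connH rhoH.
- move=> r H r6 rhoH; apply: contrapT => irrH.
  have [e0 core] := irreducible_core (ltnW r6) irrH rhoH.
  by move: rhoH; rewrite leNgt (core_spectral_radius6 R r6 core).
Qed.
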